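(* Let $m\le n$, let $X\in\mathbb{R}^{m\times n}$ and $Y=\Pi_{\mathbb{B}}(X)$, and let $S,W\in\mathbb{R}^{m\times n}$. Then $$W\in D^*\Pi_{\mathbb{B}}(X,Y)(S)\iff (W,\,W-S)\in\mathcal{N}_{\mathrm{gph}\,\partial\|\cdot\|_*}(X-Y,\,Y),$$ and $$W\in\widehat{D}^*\Pi_{\mathbb{B}}(X,Y)(S)\iff (W,\,W-S)\in\widehat{\mathcal{N}}_{\mathrm{gph}\,\partial\|\cdot\|_*}(X-Y,\,Y).$$
   Context: $\mathbb{R}^{m\times n}$ carries the trace inner product and its induced norm $\|\cdot\|_F$. $\mathbb{B}=\{Z\in\mathbb{R}^{m\times n}:\|Z\|\le1\}$ is the unit ball of the spectral norm and $\Pi_{\mathbb{B}}$ is the projection onto $\mathbb{B}$ with respect to $\|\cdot\|_F$. $\|\cdot\|_*$ is the nuclear norm, $\partial\|\cdot\|_*$ its convex subdifferential mapping, and $\mathrm{gph}\,\partial\|\cdot\|_*=\{(X,Y): Y\in\partial\|X\|_*\}$. For a set $C$ and $x\in C$: the regular normal cone is $\widehat{\mathcal N}_C(x)=\{v:\langle v,x'-x\rangle\le o(\|x'-x\|)\text{ for }x'\in C,\ x'\to x\}$; the limiting normal cone $\mathcal N_C(x)$ is the set of all limits $v=\lim_kv^k$ with $v^k\in\widehat{\mathcal N}_C(x^k)$, $x^k\in C$, $x^k\to x$. The coderivative and regular coderivative of $\Pi_{\mathbb{B}}$ at $X$ for $Y=\Pi_{\mathbb{B}}(X)$ are defined by $W\in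 D^*\Pi_{\mathbb{B}}(X,Y)(S)\iff(W,-S)\in\mathcal{N}_{\mathrm{gph}\,\Pi_{\mathbb{B}}}(X,Y)$ and $W\in\widehat D^*\Pi_{\mathbb{B}}(X,Y)(S)\iff(W,-S)\in\widehat{\mathcal{N}}_{\mathrm{gph}\,\Pi_{\mathbb{B}}}(X,Y)$. *)

(* Defs.v *)
From HB Require Import structures.
From mathcomp Require Import all_boot all_order all_algebra.
From mathcomp Require Import polyrcf.
From mathcomp Require Import all_classical all_reals all_analysis.

Set Implicit Arguments.
Unset Strict Implicit.
Unset Printing Implicit Defensive.

Import Order.TTheory GRing.Theory Num.Theory.
Import numFieldNormedType.Exports.

Local Open Scope classical_set_scope.
Local Open Scope ring_scope.

Section MatrixNorms.
Context {R : realType} {m n : nat}.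
Implicit Types A B X Y Z : 'M[R]_(m, n).

Definition mxdot A B : R := \tr (A^T *m B).

Definition frob A : R := Num.sqrt (mxdot A A).

(* The square roots of the eigenvalues of X X^T, repeated according to their
   algebraic multiplicity. As X X^T has size m, for m <= n these are exactly the
   m singular values of X. *)
Definition singular_values X : seq R :=
  let p := char_poly (X *m X^T) in
  flatten [seq nseq (mup x p) (Num.sqrt x) | x <- rootsR p].

Definition spectral_norm X : R := \big[Num.max/0]_(s <- singular_values X) s.

Definition nuclear_norm X : R := \sum_(s <- singular_values X) s.

Definition spectral_ball : set 'M[R]_(m, n) := [set Z | spectral_norm Z <= 1].

(* Nearest point of C to X for the Frobenius norm; the default value 0 is only
   reached when there is no nearest point. *)
Definition mxproj (C : set 'M[R]_(m, n)) X : 'M[R]_(m, n) :=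
  xget 0 [set Y | C Y /\ forall Z, C Z -> frob (X - Y) <= frob (X - Z)].

Definition proj_ball : 'M[R]_(m, n) -> 'M[R]_(m, n) := mxproj spectral_ball.

Definition subdiff (f : 'M[R]_(m, n) -> R) X : set 'M[R]_(m, n) :=
  [set Y | forall Z, f X + mxdot Y (Z - X) <= f Z].

Definition gph_subdiff (f : 'M[R]_(m, n) -> R) :
    set ('M[R]_(m, n) * 'M[R]_(m, n)) :=
  [set z | subdiff f z.1 z.2].

Definition gph (F : 'M[R]_(m, n) -> 'M[R]_(m, n)) :
    set ('M[R]_(m, n) * 'M[R]_(m, n)) :=
  [set z | z.2 = F z.1].

End MatrixNorms.

Section NormalCones.
Context {R : realType} {m n : nat}.
Local Notation E := ('M[R]_(m, n) * 'M[R]_(m, n))%type.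
Implicit Types (C : set E) (x v : E).

Definition pairdot x v : R := mxdot x.1 v.1 + mxdot x.2 v.2.

Definition pairnorm x : R := Num.sqrt (pairdot x x).

(* Neighbourhoods and limits in E are those of the library's (entrywise)
   topology, which in finite dimension is the topology of pairnorm. Both cones
   are empty at points outside C. *)
Definition regular_normal_cone C x : set E :=
  [set v | C x /\ forall e : R, 0 < e ->
     \forall y \near within C (nbhs x),
       pairdot v (y - x) <= e * pairnorm (y - x)].

Definition limiting_normal_cone C x : set E :=
  [set v | C x /\ exists (x_ v_ : nat -> E),
     [/\ forall k, C (x_ k),
         forall k, regular_normal_cone C (x_ k) (v_ k),
         x_ @ \oo --> x &
         v_ @ \oo --> v]].

Definition coderivative (F : 'M[R]_(m, n) -> 'M[R]_(m, n)) (X Y S : 'M[R]_(m, n))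
    : set 'M[R]_(m, n) :=
  [set W | limiting_normal_cone (gph F) (X, Y) (W, - S)].

Definition regular_coderivative (F : 'M[R]_(m, n) -> 'M[R]_(m, n))
    (X Y S : 'M[R]_(m, n)) : set 'M[R]_(m, n) :=
  [set W | regular_normal_cone (gph F) (X, Y) (W, - S)].

End NormalCones.

(* Main.v *)
Require Import Defs.
From mathcomp Require Import all_boot all_order all_algebra.
From mathcomp Require Import polyrcf complex ring lra.
From mathcomp Require Import all_classical all_reals all_analysis.

(** The heart of the matter is the equivalence
      Y = Pi_B(X)  <->  Y in the subdifferential of the nuclear norm at X - Y.
    Diagonalising X X^T by an orthogonal matrix P makes the rows of P X
    orthogonal, with the singular values of X as norms.  Hence the spectral
    ball is the set of contractions and the nuclear norm is its support
    function, so both sides say that Y is a contraction and that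
    <X - Y, Z - Y> <= 0 for every contraction Z.  Therefore the graph of Pi_B is
    the preimage of the graph of the subdifferential under the invertible
    linear map (X, Y) |-> (X - Y, Y), and normal cones of such a preimage are
    images under the adjoint, which sends (W, W - S) to (W, - S). *)

Set Implicit Arguments.
Unset Strict Implicit.
Unset Printing Implicit Defensive.

Import Order.TTheory GRing.Theory Num.Theory.
Import numFieldNormedType.Exports.

Local Open Scope ring_scope.

(** * Orthogonal diagonalisation of real symmetric matrices *)

Lemma real_symmetric_eigenvalue (R : rcfType) (n : nat) (A : 'M[R]_n.+1) :
  A^T = A -> exists a, eigenvalue A a.
Proof.
(* Over the complex extension [A] becomes hermitian, so it has a unitary diagonalisation with real
   eigenvalues; such an eigenvalue is already a root of the characteristic polynomial of [A]. *)
move=> symA; pose B := map_mx (real_complex R) A.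
have realB : B \is a mxOver Num.real.
  by apply/mxOverP => i j; rewrite mxE complex_real.
have hermB : B \is hermsymmx.
  apply: realsym_hermsym => //; apply/is_hermitianmxP.
  by rewrite expr0 scale1r map_mx_id // /B map_trmx symA.
have /orthomx_spectralP defB := hermitian_normalmx hermB.
have /mxOverP/(_ 0 0)/complex_realP[a da] := hermitian_spectral_diag_real hermB.
exists a; rewrite eigenvalue_root_char -(fmorph_root (real_complex R)).
rewrite map_char_poly -eigenvalue_root_char; apply/eigenvalueP.
have unitP := spectral_unit B.
exists (row 0 (spectralmx B)); last first.
  rewrite rowE mulmx_free_eq0 ?row_free_unit //.
  apply/eqP => /rowP/(_ 0)/eqP; rewrite !mxE !eqxx /=.
  by rewrite oner_eq0.
rewrite -[map_mx _ A]/B [in X in _ *m X]defB rowE !mulmxA mulmxK //.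
by rewrite -(rowE _ (diag_mx _)) row_diag_mx da -scalemxAl.
Qed.

Lemma sqrow_eq0 (R : realDomainType) (n : nat) (w : 'rV[R]_n) :
  ((w *m w^T) 0 0 == 0) = (w == 0).
Proof.
apply/eqP/eqP => [|->]; last by rewrite mul0mx mxE.
rewrite mxE => ww0; apply/rowP => j; rewrite [RHS]mxE; apply/eqP.
rewrite -(sqrf_eq0 (w 0 j)) expr2; apply/eqP.
have /= := psumr_eq0P _ ww0 (i := j); rewrite mxE; apply => // i _.
by rewrite mxE -expr2 sqr_ge0.
Qed.

(* Householder reflection exchanging [v] and the first basis vector. *)
Lemma orthogonal_to_first_row (R : realFieldType) (n : nat)
    (v : 'rV[R]_(1 + n)) :
  v *m v^T = 1%:M ->
  exists H : 'M[R]_(1 + n),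
    [/\ H^T = H, H *m H = 1%:M & v *m H = delta_mx 0 0].
Proof.
move=> vv; pose e : 'rV[R]_(1 + n) := delta_mx 0 0.
have [->|v_neq_e] := eqVneq v e.
  by exists 1%:M; rewrite trmx1 !mulmx1.
have ee : e *m e^T = 1%:M.
  by rewrite /e trmx_delta mul_delta_mx [LHS]mx11_scalar mxE.
(* The reflection fixes the hyperplane orthogonal to [w]. As [v] and [e] are unit vectors,
   [c = 2 (1 - s)] and <v, w> = s - 1 = - c / 2, so [v] is sent to v + w = e. *)
pose w := e - v; pose c := (w *m w^T) 0 0; pose s := (e *m v^T) 0 0.
have ev : e *m v^T = s%:M by exact: mx11_scalar.
have ve : v *m e^T = s%:M.
  by rewrite -[LHS]trmxK trmx_mul trmxK ev tr_scalar_mx.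
have c_neq0 : c != 0 by rewrite sqrow_eq0 subr_eq0 eq_sym.
have defc : c = 2 * (1 - s).
  rewrite /c /w linearB /= mulmxBl !mulmxBr ee ev ve vv !mxE eqxx !mulr1n; ring.
have vw : v *m w^T = (s - 1)%:M.
  by rewrite /w linearB /= mulmxBr ve vv -raddfB.
have ww : w *m w^T = c%:M by exact: mx11_scalar.
pose N := w^T *m w.
have NN : N *m N = c *: N.
  by rewrite /N mulmxA -(mulmxA w^T) ww mul_mx_scalar -scalemxAl.
exists (1%:M - (2 / c) *: N); split.
- by rewrite linearB linearZ /= trmx_mul trmxK trmx1.
- rewrite mulmxBl !mulmxBr mul1mx mulmx1 mul1mx -!scalemxAl -!scalemxAr NN.
  rewrite !scalerA -scalerBl -addrA -opprD -scalerDl.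
  have -> : 2 / c + (2 / c - 2 / c * (2 / c) * c) = 0 by field.
  by rewrite scale0r subr0.
- rewrite mulmxBr mulmx1 -scalemxAr mulmxA vw mul_scalar_mx scalerA.
  have -> : 2 / c * (s - 1) = - 1.
    by rewrite -[s - 1]opprB mulrN mulrAC -defc divff.
  by rewrite scaleN1r opprK addrC subrK.
Qed.

(** Induction on the size: a reflection moves a unit eigenvector to the first basis vector. The
    conjugate of [A] has first row a multiple of that vector, hence by symmetry also first column,
    and the induction hypothesis applies to the remaining block. *)
Lemma real_symmetric_diagonalizable (R : rcfType) (n : nat) (A : 'M[R]_n) :
  A^T = A ->
  exists (P : 'M[R]_n) (d : 'rV[R]_n),
    P *m P^T = 1%:M /\ P *m A *m P^T = diag_mx d.
Proof.
elim: n A => [|n IHn] A symA.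
  by exists 0, 0; split; rewrite [LHS]flatmx0 [RHS]flatmx0.
have [a /eigenvalueP[u uA u_neq0]] := real_symmetric_eigenvalue symA.
pose N := Num.sqrt ((u *m u^T) 0 0).
have uu_gt0 : 0 < (u *m u^T) 0 0.
  rewrite lt_neqAle eq_sym sqrow_eq0 u_neq0 mxE sumr_ge0 // => i _.
  by rewrite mxE -expr2 sqr_ge0.
pose v : 'rV[R]_(1 + n) := N^-1 *: u.
have vv : v *m v^T = 1%:M.
  rewrite /v linearZ /= -scalemxAl -scalemxAr scalerA [X in _ *: X]mx11_scalar.
  by rewrite scale_scalar_mx -expr2 exprVn sqr_sqrtr ?ltW // mulVf ?gt_eqF.
have vA : v *m (A : 'M[R]_(1 + n)) = a *: v.
  by rewrite /v -scalemxAl uA !scalerA mulrC.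
have [H [symH HH vH]] := orthogonal_to_first_row vv.
have eH : delta_mx 0 0 *m H = v by rewrite -vH -mulmxA HH mulmx1.
pose B := H *m (A : 'M[R]_(1 + n)) *m H.
have symB : B^T = B by rewrite /B !trmx_mul symA symH mulmxA.
have rowB : row 0 B = a *: delta_mx 0 0.
  by rewrite rowE /B !mulmxA eH vA -scalemxAl vH.
have symB' : (drsubmx B)^T = drsubmx B by rewrite trmx_drsub symB.
have [P [d [PP PB]]] := IHn _ symB'.
have l0 : lshift n 0 = 0 :> 'I_(1 + n) by apply/val_inj.
have defB : B = block_mx a%:M 0 0 (drsubmx B).
  have urB : ursubmx B = 0.
    apply/rowP => j; have /rowP/(_ (rshift 1 j)) := rowB.
    by rewrite !mxE /= l0 => ->; rewrite mulr0.
  rewrite -[LHS]submxK urB; congr block_mx.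
    rewrite [LHS]mx11_scalar !mxE l0; congr (_%:M).
    by have /rowP/(_ 0) := rowB; rewrite !mxE eqxx mulr1.
  by rewrite -symB -trmx_ursub urB trmx0.
pose Q : 'M[R]_(1 + n) := block_mx 1%:M 0 0 P.
have trQ : Q^T = block_mx 1%:M 0 0 P^T by rewrite tr_block_mx !trmx0 trmx1.
have QQ : Q *m Q^T = 1%:M.
  rewrite trQ mulmx_block !(mulmx0, mul0mx, addr0, add0r, mulmx1) PP.
  by rewrite -scalar_mx_block.
have QBQ : Q *m B *m Q^T = diag_mx (row_mx a%:M d).
  rewrite defB trQ !mulmx_block.
  rewrite !(mulmx0, mul0mx, addr0, add0r, mulmx1, mul1mx) PB diag_mx_row.
  by congr block_mx; apply/matrixP => i j; rewrite !ord1 !mxE eqxx.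
exists (Q *m H), (row_mx a%:M d); rewrite trmx_mul symH; split.
  by rewrite mulmxA -(mulmxA Q) HH mulmx1.
by rewrite -QBQ /B !mulmxA.
Qed.

(** * The trace inner product and the Cauchy-Schwarz inequality *)

Section TraceInnerProduct.
Context {R : realType}.

Lemma mxdotC m n (A B : 'M[R]_(m, n)) : mxdot A B = mxdot B A.
Proof. by rewrite /mxdot -mxtrace_tr trmx_mul trmxK. Qed.

Lemma mxdotDl m n (A B C : 'M[R]_(m, n)) :
  mxdot (A + B) C = mxdot A C + mxdot B C.
Proof. by rewrite /mxdot linearD mulmxDl linearD. Qed.

Lemma mxdotDr m n (A B C : 'M[R]_(m, n)) :
  mxdot A (B + C) = mxdot A B + mxdot A C.
Proof. by rewrite mxdotC mxdotDl !(mxdotC A). Qed.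

Lemma mxdotZl m n a (A B : 'M[R]_(m, n)) : mxdot (a *: A) B = a * mxdot A B.
Proof. by rewrite /mxdot linearZ -scalemxAl linearZ. Qed.

Lemma mxdotZr m n a (A B : 'M[R]_(m, n)) : mxdot A (a *: B) = a * mxdot A B.
Proof. by rewrite mxdotC mxdotZl mxdotC. Qed.

Lemma mxdotNl m n (A B : 'M[R]_(m, n)) : mxdot (- A) B = - mxdot A B.
Proof. by rewrite -scaleN1r mxdotZl mulN1r. Qed.

Lemma mxdotNr m n (A B : 'M[R]_(m, n)) : mxdot A (- B) = - mxdot A B.
Proof. by rewrite mxdotC mxdotNl mxdotC. Qed.

Lemma mxdotBl m n (A B C : 'M[R]_(m, n)) :
  mxdot (A - B) C = mxdot A C - mxdot B C.
Proof. by rewrite mxdotDl mxdotNl. Qed.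

Lemma mxdotBr m n (A B C : 'M[R]_(m, n)) :
  mxdot A (B - C) = mxdot A B - mxdot A C.
Proof. by rewrite mxdotDr mxdotNr. Qed.

Lemma mxdot0l m n (A : 'M[R]_(m, n)) : mxdot 0 A = 0.
Proof. by rewrite -(scale0r 0) mxdotZl mul0r. Qed.

Lemma mxdot0r m n (A : 'M[R]_(m, n)) : mxdot A 0 = 0.
Proof. by rewrite mxdotC mxdot0l. Qed.

Lemma mxdotE m n (A B : 'M[R]_(m, n)) :
  mxdot A B = \sum_i \sum_j A i j * B i j.
Proof.
rewrite exchange_big; apply: eq_bigr => j _; rewrite mxE.
by apply: eq_bigr => i _; rewrite mxE.
Qed.

Lemma mxdot_rows m n (A B : 'M[R]_(m, n)) :
  mxdot A B = \sum_i mxdot (row i A) (row i B).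
Proof.
rewrite mxdotE; apply: eq_bigr => i _.
rewrite mxdotE big_ord_recl big_ord0 addr0.
by apply: eq_bigr => j _; rewrite !mxE.
Qed.

Lemma mxdot_row n (u v : 'rV[R]_n) : mxdot u v = (u *m v^T) 0 0.
Proof.
by rewrite mxdotC /mxdot mxtrace_mulC /mxtrace big_ord_recl big_ord0 addr0.
Qed.

Lemma mxdot_row_row m n p (A : 'M[R]_(m, n)) (B : 'M[R]_(p, n)) i j :
  mxdot (row i A) (row j B) = (A *m B^T) i j.
Proof.
by rewrite mxdot_row mxE [RHS]mxE; apply: eq_bigr => k _; rewrite !mxE.
Qed.

Lemma mxdot_ge0 m n (A : 'M[R]_(m, n)) : 0 <= mxdot A A.
Proof.
by rewrite mxdotE !sumr_ge0 // => i _; rewrite sumr_ge0 // => j _;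
  rewrite -expr2 sqr_ge0.
Qed.

Lemma mxdot_eq0 m n (A : 'M[R]_(m, n)) : mxdot A A = 0 -> A = 0.
Proof.
rewrite mxdot_rows => A0; apply/row_matrixP => i; rewrite row0; apply/eqP.
rewrite -sqrow_eq0 -mxdot_row; apply/eqP.
by rewrite (psumr_eq0P _ A0) // => j _; exact: mxdot_ge0.
Qed.

Lemma frob_ge0 m n (A : 'M[R]_(m, n)) : 0 <= frob A.
Proof. exact: sqrtr_ge0. Qed.

Lemma sqr_frob m n (A : 'M[R]_(m, n)) : frob A ^+ 2 = mxdot A A.
Proof. by rewrite sqr_sqrtr ?mxdot_ge0. Qed.

Lemma mxdot_le_frob m n (A B : 'M[R]_(m, n)) :
  mxdot A B <= frob A * frob B.
Proof.
have [/eqP|A_neq0] := eqVneq (frob A) 0.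
  rewrite -sqrf_eq0 sqr_frob => /eqP/mxdot_eq0 ->.
  by rewrite mxdot0l mulr_ge0 ?frob_ge0.
have [/eqP|B_neq0] := eqVneq (frob B) 0.
  rewrite -sqrf_eq0 sqr_frob => /eqP/mxdot_eq0 ->.
  by rewrite mxdot0r mulr_ge0 ?frob_ge0.
have A_gt0 : 0 < frob A by rewrite lt_neqAle eq_sym A_neq0 frob_ge0.
have B_gt0 : 0 < frob B by rewrite lt_neqAle eq_sym B_neq0 frob_ge0.
(* This square expands to 2 |A| |B| (|A| |B| - <A, B>), and the factor |A| |B| is positive. *)
have := mxdot_ge0 (frob B *: A - frob A *: B).
rewrite !(mxdotBl, mxdotBr, mxdotZl, mxdotZr) -!sqr_frob (mxdotC B) => pos.
rewrite -(ler_pM2l (mulr_gt0 A_gt0 B_gt0)); nra.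
Qed.

Lemma mxdot_mulmxl m n p (A : 'M[R]_(m, n)) (B : 'M[R]_(n, p))
    (C : 'M[R]_(m, p)) :
  mxdot (A *m B) C = mxdot B (A^T *m C).
Proof. by rewrite /mxdot trmx_mul mulmxA. Qed.

Lemma mxdot_mulmxr m n p (A : 'M[R]_(m, n)) (B : 'M[R]_(n, p))
    (C : 'M[R]_(m, p)) :
  mxdot (A *m B) C = mxdot A (C *m B^T).
Proof. by rewrite /mxdot trmx_mul -mulmxA mxtrace_mulC mulmxA. Qed.

End TraceInnerProduct.

(** * Singular values, and the spectral ball as the set of contractions *)

Section Contractions.
Context {R : realType}.

(** Operator norm at most 1 for the action on row vectors, stated without singular values and with
    squared norms. *)
Definition contraction m n (X : 'M[R]_(m, n)) :=
  forall u : 'rV[R]_m, mxdot (u *m X) (u *m X) <= mxdot u u.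

Definition row_orthogonal m n (M : 'M[R]_(m, n)) :=
  forall i j, i != j -> mxdot (row i M) (row j M) = 0.

Lemma contraction_frob m n (X : 'M[R]_(m, n)) (u : 'rV[R]_m) :
  contraction X -> frob (u *m X) <= frob u.
Proof. by move=> cX; apply: ler_wsqrtr. Qed.

Lemma contraction_mul_isometry m n p (P : 'M[R]_(m, n)) (X : 'M[R]_(n, p)) :
  P *m P^T = 1%:M -> contraction X -> contraction (P *m X).
Proof.
move=> PP cX u; rewrite mulmxA; apply: le_trans (cX _) _.
by rewrite mxdot_mulmxr -mulmxA PP mulmx1.
Qed.

Lemma row_orthogonal_mul m n (M : 'M[R]_(m, n)) (u : 'rV[R]_m) :
  row_orthogonal M ->
  mxdot (u *m M) (u *m M) = \sum_i u 0 i ^+ 2 * mxdot (row i M) (row i M).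
Proof.
move=> oM; rewrite mulmx_sum_row.
have dot_suml (F : 'I_m -> 'rV[R]_n) v :
    mxdot (\sum_i F i) v = \sum_i mxdot (F i) v.
  exact: (big_morph (mxdot^~ v) (fun x y => mxdotDl x y v) (mxdot0l v)).
rewrite dot_suml; apply: eq_bigr => i _.
rewrite mxdotC dot_suml (bigD1 i) //= big1 => [|j ji].
  by rewrite addr0 mxdotZl mxdotZr mulrA.
by rewrite mxdotZl mxdotZr oM // !mulr0.
Qed.

Lemma row_orthogonal_contraction m n (M : 'M[R]_(m, n)) :
  row_orthogonal M -> (forall i, frob (row i M) <= 1) -> contraction M.
Proof.
move=> oM M1 u.
rewrite row_orthogonal_mul // mxdotE big_ord_recl big_ord0 addr0.
apply: ler_sum => i _; rewrite -expr2 -[leRHS]mulr1 ler_wpM2l ?sqr_ge0 //.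
by rewrite -sqr_frob expr_le1 ?frob_ge0.
Qed.

Lemma row_orthogonal_diag_mul m n (c : 'rV[R]_m) (M : 'M[R]_(m, n)) :
  row_orthogonal M -> row_orthogonal (diag_mx c *m M).
Proof.
move=> oM i j ij; rewrite !row_mul !row_diag_mx -!scalemxAl -!rowE.
by rewrite mxdotZl mxdotZr oM // !mulr0.
Qed.

Lemma row_diag_mul m n (c : 'rV[R]_m) (M : 'M[R]_(m, n)) i :
  row i (diag_mx c *m M) = c 0 i *: row i M.
Proof. by rewrite row_mul row_diag_mx -scalemxAl -rowE. Qed.

Lemma frobZ m n a (X : 'M[R]_(m, n)) : frob (a *: X) = `|a| * frob X.
Proof.
by rewrite /frob mxdotZl mxdotZr mulrA sqrtrM -?expr2 ?sqr_ge0 // sqrtr_sqr.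
Qed.

Lemma frob_row_orthogonal_mx m (P : 'M[R]_m) i :
  P *m P^T = 1%:M -> frob (row i P) = 1.
Proof. by move=> PP; rewrite /frob mxdot_row_row PP mxE eqxx sqrtr1.
Qed.

Lemma char_poly_orthogonal_diag m (A P : 'M[R]_m) d :
  P *m P^T = 1%:M -> P *m A *m P^T = diag_mx d ->
  char_poly A = \prod_(x <- [seq d 0 i | i <- enum 'I_m]) ('X - x%:P).
Proof.
move=> PP PAP; transitivity (char_poly (diag_mx d)); last first.
  rewrite char_poly_trig ?diag_mx_is_trig // big_map enumT.
  by apply: eq_bigr => i _; rewrite mxE eqxx.
(* Conjugating the characteristic matrix by [Q] keeps its determinant, since the determinants of [Q]
   and [Q^T] have product 1. *)
pose Q := map_mx (@polyC R) P.
have QQ : Q *m Q^T = 1%:M by rewrite /Q map_trmx -map_mxM PP map_mx1.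
have dQ : \det Q * \det Q^T = 1 by rewrite -det_mulmx QQ det1.
rewrite /char_poly -[LHS]mulr1 -dQ mulrCA mulrA -!det_mulmx; congr (\det _).
rewrite /char_poly_mx mulmxBr mulmxBl -PAP !map_mxM -map_trmx -/Q.
by rewrite mul_mx_scalar -scalemxAl QQ scalemx1.
Qed.

(** This plays the role of a singular value decomposition. If [P] diagonalises X X^T, the Gram
    matrix of the rows of P X is diagonal: the rows are orthogonal and their squared norms are the
    eigenvalues. *)
Lemma singular_values_decomposition m n (X : 'M[R]_(m, n)) :
  exists P : 'M[R]_m,
    [/\ P *m P^T = 1%:M, row_orthogonal (P *m X) &
        perm_eq (singular_values X)
          [seq frob (row i (P *m X)) | i <- enum 'I_m]].
Proof.
have symX : (X *m X^T)^T = X *m X^T by rewrite trmx_mul trmxK.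
have [P [d [PP Pd]]] := real_symmetric_diagonalizable symX.
have dotP i j : mxdot (row i (P *m X)) (row j (P *m X)) = diag_mx d i j.
  by rewrite -Pd mxdot_row_row trmx_mul !mulmxA.
exists P; split=> // [i j /negPf ij|]; first by rewrite dotP mxE ij.
set s := [seq d 0 i | i <- enum 'I_m].
have defp := char_poly_orthogonal_diag PP Pd; rewrite -/s in defp.
have -> : [seq frob (row i (P *m X)) | i <- enum 'I_m] = map Num.sqrt s.
  by rewrite /s -map_comp; apply: eq_map => i; rewrite /= /frob dotP mxE eqxx.
have -> : singular_values X =
    map Num.sqrt (flatten [seq nseq (count_mem x s) x |
                           x <- rootsR (\prod_(x <- s) ('X - x%:P))]).
  rewrite /singular_values defp map_flatten -map_comp; congr flatten.
  by apply: eq_map => x; rewrite /= map_nseq mu_prod_XsubC.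
(* Both [rootsR] and [undup s] list the distinct eigenvalues once each; repeating them by
   multiplicity recovers [s] up to order. *)
apply/perm_map/(perm_trans _ (perm_count_undup s))/perm_flatten/perm_map.
apply: uniq_perm => [||x]; rewrite ?undup_uniq ?uniq_roots //.
have := roots_on_rootsR (monic_neq0 (monic_prod_XsubC s xpredT id)) => /(_ x).
by rewrite mem_undup root_prod_XsubC in_itv /= => ->.
Qed.

Lemma nuclear_normE m n (X : 'M[R]_(m, n)) (P : 'M[R]_m) :
  perm_eq (singular_values X) [seq frob (row i (P *m X)) | i <- enum 'I_m] ->
  nuclear_norm X = \sum_i frob (row i (P *m X)).
Proof. by move=> svX; rewrite /nuclear_norm (perm_big _ svX) big_map enumT. Qed.

Lemma spectral_norm_le1 m n (X : 'M[R]_(m, n)) :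
  spectral_norm X <= 1 <-> {in singular_values X, forall s, s <= 1}.
Proof.
rewrite /spectral_norm; elim: (singular_values X) => [|s l IHl].
  by rewrite big_nil ler01.
rewrite big_cons ge_max; split=> [/andP[s1 /IHl l1] x|l1].
  by rewrite inE => /predU1P[->|/l1].
rewrite l1 ?mem_head //=; apply/IHl => x xl.
by rewrite l1 // inE xl orbT.
Qed.

(** In X = P^T (P X) the factor P^T is an isometry, and P X has orthogonal rows, so row norms at
    most 1 suffice. Conversely, row i of P X is the image under X of the unit vector [row i P]. *)
Lemma spectral_ballE m n (X : 'M[R]_(m, n)) :
  spectral_ball X <-> contraction X.
Proof.
have [P [PP oPX svX]] := singular_values_decomposition X.
have PP' := mulmx1C PP.
rewrite /spectral_ball /= spectral_norm_le1; split=> [X1|cX s].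
  rewrite -[X]mul1mx -PP' -mulmxA; apply: contraction_mul_isometry.
    by rewrite trmxK.
  apply: row_orthogonal_contraction => // i; apply: X1.
  by rewrite (perm_mem svX); apply/mapP; exists i; rewrite ?mem_enum.
rewrite (perm_mem svX) => /mapP[i _ ->].
by rewrite row_mul -(frob_row_orthogonal_mx i PP) contraction_frob.
Qed.

End Contractions.

(** * The nuclear norm as support function of the contractions, and its subdifferential *)

Section NuclearNorm.
Context {R : realType} {m n : nat}.
Implicit Types X Y Z U : 'M[R]_(m, n).

(** Since <Y, X> = <P Y, P X>, Cauchy-Schwarz applies row by row; the rows of P Y have norm at most
    1. *)
Lemma mxdot_le_nuclear_norm Y X : contraction Y -> mxdot Y X <= nuclear_norm X.
Proof.
move=> cY; have [P [PP _ /nuclear_normE ->]] := singular_values_decomposition X.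
have PP' := mulmx1C PP.
rewrite -[Y]mul1mx -PP' -mulmxA mxdot_mulmxl trmxK mxdot_rows.
apply: ler_sum => i _; apply: le_trans (mxdot_le_frob _ _) _.
rewrite -[leRHS]mul1r ler_wpM2r ?frob_ge0 //.
by rewrite row_mul -(frob_row_orthogonal_mx i PP) contraction_frob.
Qed.

(** Normalising the orthogonal rows of P X and rotating back by P^T gives a contraction that pairs
    with each row to its norm. *)
Lemma nuclear_norm_attained X :
  exists2 U, contraction U & mxdot U X = nuclear_norm X.
Proof.
have [P [PP oPX /nuclear_normE ->]] := singular_values_decomposition X.
have PP' := mulmx1C PP.
(* [0^-1 = 0] handles the vanishing rows. *)
pose c : 'rV[R]_m := \row_i (frob (row i (P *m X)))^-1.
exists (P^T *m (diag_mx c *m (P *m X))).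
  apply: contraction_mul_isometry; first by rewrite trmxK.
  apply: row_orthogonal_contraction; first exact: row_orthogonal_diag_mul.
  move=> i; rewrite row_diag_mul frobZ mxE ger0_norm ?invr_ge0 ?frob_ge0 //.
  have [->|/mulVf -> //] := eqVneq (frob (row i (P *m X))) 0.
  by rewrite mulr0.
rewrite mxdot_mulmxl trmxK mxdot_rows; apply: eq_bigr => i _.
rewrite row_diag_mul mxdotZl mxE -sqr_frob expr2.
have [->|/mulVf f0] := eqVneq (frob (row i (P *m X))) 0.
  by rewrite !mulr0.
by rewrite mulrA f0 mul1r.
Qed.

(* Tested on the rank one matrix [u^T (u Y)], whose nuclear norm is
   [|u| |u Y|]. *)
Lemma contraction_nuclear_dual Y :
  (forall Z, mxdot Y Z <= nuclear_norm Z) -> contraction Y.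
Proof.
move=> Yle u; pose Z := u^T *m (u *m Y).
have [U cU UZ] := nuclear_norm_attained Z.
have YZ : mxdot Y Z = frob (u *m Y) ^+ 2.
  by rewrite /Z mxdotC mxdot_mulmxl trmxK sqr_frob.
have UZ' : mxdot U Z = mxdot (u *m U) (u *m Y).
  by rewrite /Z mxdotC mxdot_mulmxl trmxK mxdotC.
have := Yle Z; rewrite -UZ UZ' YZ => le1.
have le2 := le_trans le1 (mxdot_le_frob _ _).
have le3 := contraction_frob u cU.
rewrite -!sqr_frob ler_sqr ?nnegrE ?frob_ge0 //.
have := frob_ge0 (u *m Y); rewrite le_eqVlt => /predU1P[<-|uY_gt0].
  exact: frob_ge0.
rewrite -(ler_pM2r uY_gt0) -expr2; apply: le_trans le2 _.
by rewrite ler_pM2r.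
Qed.

(** General fact on support functions: the subgradients at [X] are the points of the set that
    maximise <X, .> over it. *)
Lemma subdiff_nuclear_normE X Y :
  subdiff nuclear_norm X Y <->
  contraction Y /\ (forall Z, contraction Z -> mxdot X (Z - Y) <= 0).
Proof.
split=> [YX|[cY XY] Z].
  have nuc0 : nuclear_norm (0 : 'M[R]_(m, n)) = 0.
    by have [U _ <-] := nuclear_norm_attained 0; rewrite mxdot0r.
  have cY : contraction Y.
    apply: contraction_nuclear_dual => Z.
    (* The subgradient inequality at X + Z, with <U, X> and <U, Z> bounded by the nuclear norms of X
       and Z, leaves <Y, Z> at most the nuclear norm of Z. *)
    have [U cU UZ] := nuclear_norm_attained (X + Z).
    have := YX (X + Z); rewrite -UZ (addrC X) addrK mxdotDr.
    have := mxdot_le_nuclear_norm X cU; have := mxdot_le_nuclear_norm Z cU.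
    by lra.
  (* At 0 the subgradient inequality bounds the nuclear norm of X by <Y, X>, so [Y] is a
     maximiser. *)
  split=> // Z cZ; have := YX 0; rewrite nuc0 sub0r mxdotNr.
  have := mxdot_le_nuclear_norm X cZ.
  by rewrite mxdotBr !(mxdotC X); lra.
have [U cU <-] := nuclear_norm_attained X.
have := XY U cU; have := mxdot_le_nuclear_norm Z cY.
by rewrite !mxdotBr !(mxdotC X); lra.
Qed.

End NuclearNorm.

(** * The projection onto the spectral ball *)

Section Projection.
Context {R : realType} {m n : nat}.
Implicit Types X Y Z : 'M[R]_(m, n).

(** The variational inequality yields |X - Z|^2 >= |X - Y|^2 + |Y - Z|^2 on [C], which makes [Y] a
    nearest point and the only one. *)
Lemma mxproj_unique (C : set 'M[R]_(m, n)) X Y :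
  C Y -> (forall Z, C Z -> mxdot (X - Y) (Z - Y) <= 0) -> mxproj C X = Y.
Proof.
move=> CY vi.
have expand Z : mxdot (X - Z) (X - Z) =
    mxdot (X - Y) (X - Y) + mxdot (Y - Z) (Y - Z) - 2 * mxdot (X - Y) (Z - Y).
  rewrite -(subrKA Y X (- Z)) -[Z - Y]opprB mxdotNr.
  move: (X - Y) (Y - Z) => A B.
  rewrite mxdotDl !mxdotDr (mxdotC B A); ring.
rewrite /mxproj; case: xgetP => [Y' ? [CY' near]|/(_ Y) []].
  have := near Y CY; rewrite -ler_sqr ?nnegrE ?frob_ge0 // !sqr_frob.
  rewrite (expand Y'); have := vi _ CY'.
  have := mxdot_ge0 (Y - Y') => ge0 le0 le1.
  apply/esym/subr0_eq/mxdot_eq0; apply/eqP; rewrite eq_le ge0 andbT; lra.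
(* [Y] itself is a nearest point, which excludes the default value of [xget]. *)
split=> // Z CZ; rewrite -ler_sqr ?nnegrE ?frob_ge0 // !sqr_frob (expand Z).
have := vi _ CZ; have := mxdot_ge0 (Y - Z); lra.
Qed.

(* Truncate the singular values at 1. *)
Lemma contraction_projection X :
  exists Y, contraction Y /\
    (forall Z, contraction Z -> mxdot (X - Y) (Z - Y) <= 0).
Proof.
have [P [PP oPX _]] := singular_values_decomposition X.
have PP' := mulmx1C PP; pose s i := frob (row i (P *m X)).
pose c : 'rV[R]_m := \row_i (if s i <= 1 then 1 else (s i)^-1).
(* The last identity is complementarity: a row is either kept (c = 1) or cut to norm exactly 1 (c s
   = 1). *)
have cs i : [/\ 0 <= c 0 i, c 0 i <= 1, c 0 i * s i <= 1 &
    (1 - c 0 i) * (1 - c 0 i * s i) = 0].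
  rewrite mxE; case: ifPn => [si|].
    by rewrite subrr !mul0r mul1r; split; rewrite ?ler01.
  rewrite -ltNge => si; have s0 : 0 < s i by lra.
  rewrite mulVf ?gt_eqF // subrr mulr0; split=> //.
    by rewrite invr_ge0 ltW.
  by rewrite invf_le1 // ltW.
pose Y := P^T *m (diag_mx c *m (P *m X)).
have PY : P *m Y = diag_mx c *m (P *m X) by rewrite /Y mulmxA PP mul1mx.
exists Y; split.
  apply: contraction_mul_isometry; first by rewrite trmxK.
  apply: row_orthogonal_contraction; first exact: row_orthogonal_diag_mul.
  move=> i; rewrite row_diag_mul frobZ ger0_norm; by have [] := cs i.
move=> Z cZ.
rewrite -[X - Y]mul1mx -PP' -mulmxA mxdot_mulmxl trmxK mxdot_rows.
apply: sumr_le0 => i _; rewrite !mulmxBr PY !linearB /= row_diag_mul.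
have [_ c1 _ cs0] := cs i.
rewrite -[X in mxdot (X - _)]scale1r -scalerBl mxdotZl mxdotBr mxdotZr.
rewrite -sqr_frob -/(s i).
have rowZ : frob (row i (P *m Z)) <= 1.
  by rewrite row_mul -(frob_row_orthogonal_mx i PP) contraction_frob.
have le1 := mxdot_le_frob (row i (P *m X)) (row i (P *m Z)).
rewrite -/(s i) in le1.
have s0 : 0 <= s i := frob_ge0 _.
have le2 : mxdot (row i (P *m X)) (row i (P *m Z)) <= s i.
  by apply: le_trans le1 _; rewrite -[leRHS]mulr1 ler_wpM2l.
have c1' : 0 <= 1 - c 0 i by rewrite subr_ge0.
have le3 := ler_wpM2l c1' le2.
(* The contribution of row i is at most (1 - c) (s - c s^2) = (1 - c) (1 - c s) s, which vanishes by
   complementarity. *)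
rewrite mulrBr; apply: le_trans (lerB le3 (lexx _)) _.
rewrite -mulrBr [X in _ * X](_ : _ = (1 - c 0 i * s i) * s i); last by ring.
by rewrite mulrA cs0 mul0r.
Qed.

Lemma proj_ball_subdiff X Y :
  Y = proj_ball X <-> subdiff nuclear_norm (X - Y) Y.
Proof.
have vi_proj Y' : contraction Y' ->
    (forall Z, contraction Z -> mxdot (X - Y') (Z - Y') <= 0) ->
    proj_ball X = Y'.
  move=> cY' vi; apply: mxproj_unique => [|Z /spectral_ballE /vi //].
  exact/spectral_ballE.
rewrite subdiff_nuclear_normE; split=> [->|[cY vi]]; last exact/esym/vi_proj.
(* Existence matters here: the projection is known to satisfy the variational inequality only
   because some point does. *)
by have [Y' [cY' vi]] := contraction_projection X; rewrite (vi_proj Y').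
Qed.

End Projection.

(** * Normal cones under shears of the product space *)

Section Shear.
Context {R : realType} {m n : nat}.
Local Notation E := ('M[R]_(m, n) * 'M[R]_(m, n))%type.
Implicit Types (x y v : E) (t : R).
Local Open Scope classical_set_scope.

(** The graphs are related by t = -1. A general [t] is kept because the inverse is the shear by - t,
    so one implication serves both directions. *)
Definition shear t x : E := (x.1 + t *: x.2, x.2).

Definition shear_adjoint t v : E := (v.1, v.2 + t *: v.1).

Lemma shearB t x y : shear t (x - y) = shear t x - shear t y.
Proof.
congr pair => /=; rewrite scalerBr opprD !addrA; congr (_ + _).
by rewrite -!addrA; congr (_ + _); rewrite addrC.
Qed.

Lemma shearK t : cancel (shear t) (shear (- t)).
Proof. by case=> a b; rewrite /shear /= scaleNr addrK. Qed.

Lemma shear_adjointK t : cancel (shear_adjoint t) (shear_adjoint (- t)).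
Proof. by case=> a b; rewrite /shear_adjoint /= scaleNr addrK. Qed.

Lemma pairdot_shear t x v :
  pairdot v (shear t x) = pairdot (shear_adjoint t v) x.
Proof.
rewrite /pairdot /= mxdotDr mxdotDl mxdotZr mxdotZl.
by rewrite -addrA; congr (_ + _); rewrite addrC.
Qed.

Lemma continuous_shear t : continuous (shear t).
Proof.
move=> x; apply: (@cvg_pair _ _ _ _ (nbhs (x.1 + t *: x.2)) (nbhs x.2)).
  by apply: cvgD; [exact: cvg_fst|apply: cvgZl_tmp; exact: cvg_snd].
exact: cvg_snd.
Qed.

Lemma continuous_shear_adjoint t : continuous (shear_adjoint t).
Proof.
move=> x; apply: (@cvg_pair _ _ _ _ (nbhs x.1) (nbhs (x.2 + t *: x.1))).
  exact: cvg_fst.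
by apply: cvgD; [exact: cvg_snd|apply: cvgZl_tmp; exact: cvg_fst].
Qed.

Lemma pairnorm_ge0 x : 0 <= pairnorm x.
Proof. exact: sqrtr_ge0. Qed.

Lemma sqr_pairnorm x : pairnorm x ^+ 2 = pairdot x x.
Proof. by rewrite sqr_sqrtr // addr_ge0 ?mxdot_ge0. Qed.

(** By |a - t b|^2 >= 0, |a + t b|^2 <= 2 |a|^2 + 2 t^2 |b|^2, so the squared norm is at most 2
    |a|^2 + 3 |b|^2. The constant 2 is not sharp; a Lipschitz bound is all that is wanted. *)
Lemma pairnorm_shear t x : `|t| <= 1 -> pairnorm (shear t x) <= 2 * pairnorm x.
Proof.
move=> t1; have tt1 : t ^+ 2 <= 1 by rewrite -real_normK ?num_real // expr_le1.
rewrite -ler_sqr ?nnegrE ?mulr_ge0 ?pairnorm_ge0 // exprMn !sqr_pairnorm.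
case: x => a b; rewrite /pairdot /=.
have := mxdot_ge0 (a - t *: b).
rewrite mxdotBl !mxdotBr !mxdotDl !mxdotDr !mxdotZl !mxdotZr (mxdotC b a).
have := mxdot_ge0 a; have := mxdot_ge0 b; nra.
Qed.

Lemma regular_normal_cone_shear t (C : set E) x v : `|t| <= 1 ->
  regular_normal_cone C (shear t x) v ->
  regular_normal_cone (shear t @^-1` C) x (shear_adjoint t v).
Proof.
move=> t1 [Cx nv]; split=> // e e_gt0.
(* Halving [e] absorbs the Lipschitz constant 2 of the shear. *)
have := nv (e / 2) ltac:(by rewrite divr_gt0).
rewrite !near_withinE => /continuous_shear nv_t.
apply: (@filterS _ (nbhs x) _ _ _ _ nv_t) => y le_y Cy.
rewrite -pairdot_shear shearB; apply: le_trans (le_y Cy) _.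
rewrite -shearB -mulrA ler_pM2l // mulrC ler_pdivrMr // mulrC.
exact: pairnorm_shear.
Qed.

(** Base points are pulled back by the inverse shear and normals transported by the adjoint; both
    maps are continuous, so the limits persist. *)
Lemma limiting_normal_cone_shear t (C : set E) x v : `|t| <= 1 ->
  limiting_normal_cone C (shear t x) v ->
  limiting_normal_cone (shear t @^-1` C) x (shear_adjoint t v).
Proof.
move=> t1 [Cx [x_ [v_ [Cx_ nv_ cx cv]]]]; split=> //.
exists (shear (- t) \o x_), (shear_adjoint t \o v_).
have xK k : shear t (shear (- t) (x_ k)) = x_ k.
  by rewrite -{1}[t]opprK shearK.
split=> [k|k||].
- by rewrite /= xK.
- by apply: regular_normal_cone_shear; rewrite //= xK.
- by rewrite -(shearK t x); apply: cvg_comp cx _; exact: continuous_shear.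
- by apply: cvg_comp cv _; exact: continuous_shear_adjoint.
Qed.

(* Each implication applied with [- t] gives its converse. *)
Lemma normal_cone_shearE t (C D : set E) x v : `|t| <= 1 ->
  (forall y, D y <-> C (shear t y)) ->
  (limiting_normal_cone D x (shear_adjoint t v) <->
     limiting_normal_cone C (shear t x) v) /\
  (regular_normal_cone D x (shear_adjoint t v) <->
     regular_normal_cone C (shear t x) v).
Proof.
move=> t1 DC.
have -> : D = shear t @^-1` C by apply/predeqP.
have defC : C = shear (- t) @^-1` (shear t @^-1` C).
  by apply/predeqP => y; rewrite /preimage /= -{1}[t]opprK shearK.
have t1' : `|- t| <= 1 by rewrite normrN.
split; split.
- rewrite {2}defC -{2}(shear_adjointK t v) -{1}(shearK t x).
  exact: limiting_normal_cone_shear.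
- exact: limiting_normal_cone_shear.
- rewrite {2}defC -{2}(shear_adjointK t v) -{1}(shearK t x).
  exact: regular_normal_cone_shear.
- exact: regular_normal_cone_shear.
Qed.

End Shear.

Theorem mainTheorem4 (R : realType) (m n : nat) (hmn : (m <= n)%N)
    (X Y S W : 'M[R]_(m, n)) (hY : Y = proj_ball X) :
  (coderivative proj_ball X Y S W <->
     limiting_normal_cone (gph_subdiff nuclear_norm) (X - Y, Y) (W, W - S)) /\
  (regular_coderivative proj_ball X Y S W <->
     regular_normal_cone (gph_subdiff nuclear_norm) (X - Y, Y) (W, W - S)).
Proof.
have gphE (z : 'M[R]_(m, n) * 'M[R]_(m, n)) :
    gph proj_ball z <-> gph_subdiff nuclear_norm (shear (-1) z).
  by rewrite /gph_subdiff /= scaleN1r; exact: proj_ball_subdiff.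
have t1 : `|-1| <= 1 :> R by rewrite normrN1.
have := normal_cone_shearE (X, Y) (W, W - S) t1 gphE.
(* The second component of the adjoint is (W - S) - W = - S. *)
by rewrite /shear /shear_adjoint /= !scaleN1r addrAC subrr sub0r.
Qed.
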